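(* Let $\rho>0$ and let the parameters of the AADMM algorithm (described in the context) be $\alpha_t\equiv1$, $\theta_t\equiv\tau_t\equiv\rho_t\equiv\rho$ and $\eta_t\equiv\eta$ with $\eta\ge L_G+\chi\rho\|K\|^2$. Then for every $t\in\{1,\dots,N-1\}$, with $x^{t+1}:=\frac1t\sum_{i=2}^{t+1}x_i$ and $w^{t+1}:=\frac1t\sum_{i=2}^{t+1}w_i$, $$G(x^{t+1})+F(w^{t+1})-f^*\le\frac1{2t}\big(\eta D_{x^*}^2+\rho(1-\chi)D_{x^*,K}^2\big)$$ and $$\|Bw^{t+1}-Kx^{t+1}-b\|^2\le\frac2{t^2}\Big(\frac{2D_{y^*}^2}{\rho^2}+\frac{\eta D_{x^*}^2}\rho+(1-\chi)D_{x^*,K}^2\Big).$$ In particular, if $\rho=1$ and $\eta=L_G+\chi\|K\|^2$, then $$G(x^{t+1})+F(w^{t+1})-f^*\le\frac1{2t}\big(L_GD_{x^*}^2+\chi\|K\|^2D_{x^*}^2+(1-\chi)D_{x^*,K}^2\big)$$ and $$\|Bw^{t+1}-Kx^{t+1}-b\|\le\frac{2\sqrt{L_G}D_{x^*}}t+\frac{\chi\sqrt2\|K\|D_{x^*}}t+\frac{(1-\chi)\sqrt2D_{x^*,K}}t+\frac{2D_{y^*}}t.$$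
   Context: $\mathcal W,\mathcal X,\mathcal Y$ are finite-dimensional real inner product spaces with induced norms $\|\cdot\|$; $X\subseteq\mathcal X$ is closed and convex (not necessarily bounded); $G:X\to\mathbb R$ and $F:\mathcal W\to\mathbb R$ are finite-valued, convex and lower semicontinuous; $K:\mathcal X\to\mathcal Y$ and $B:\mathcal W\to\mathcal Y$ are linear operators, $\|K\|$ is the operator norm; $b\in\mathcal Y$. $G$ is continuously differentiable and there is $L_G>0$ with $G(x_2)-G(x_1)-\langle\nabla G(x_1),x_2-x_1\rangle\le\frac{L_G}{2}\|x_2-x_1\|^2$ for all $x_1,x_2\in X$. Problem: minimize $G(x)+F(w)$ over $x\in X$, $w\in\mathcal W$ subject to $Bw-Kx=b$. It is assumed that there is an optimal solution $(w^*,x^* )$ and $y^*\in\mathcal Y$ such that $(w^*,x^*,y^* )$ is a saddle point of $\min_{x\in X,w\in\mathcal W}\max_{y\in\mathcal Y}G(x)+F(w)-\langle y,Bw-Kx-b\rangle$. $f^*:=G(x^* )+F(w^* )$ is the optimal value. Constants: $D_{x^*}:=\|x_1-x^*\|$, $D_{x^*,K}:=\|K(x_1-x^* )\|$, $D_{y^*}:=\|y_1-y^*\|$. AADMM algorithm. Parameters: $\chi\in\{0,1\}$, $N\ge2$, sequences $\alpha_t,\theta_t,\tau_t,\rho_t,\eta_t$. Choose $x_1\in X$, $w_1\in\mathcal W$ with $Bw_1=Kx_1+b$; set $x_1^{ag}=x_1$, $w_1^{ag}=w_1$, $y_1^{ag}=y_1=0$. For $t=1,\dots,N-1$ (minimizers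 are assumed to exist; any minimizer may be taken): $$\begin{aligned}x_t^{md}&=(1-\alpha_t)x_t^{ag}+\alpha_tx_t,\\ x_{t+1}&\in\operatorname*{argmin}_{x\in X}\ \langle\nabla G(x_t^{md}),x\rangle-\chi\theta_t\langle Bw_t-Kx_t-b,Kx\rangle+\tfrac{(1-\chi)\theta_t}2\|Bw_t-Kx-b\|^2+\langle y_t,Kx\rangle+\tfrac{\eta_t}2\|x-x_t\|^2,\\ x_{t+1}^{ag}&=(1-\alpha_t)x_t^{ag}+\alpha_tx_{t+1},\\ w_{t+1}&\in\operatorname*{argmin}_{w\in\mathcal W}\ F(w)-\langle y_t,Bw\rangle+\tfrac{\tau_t}2\|Bw-Kx_{t+1}-b\|^2,\\ w_{t+1}^{ag}&=(1-\alpha_t)w_t^{ag}+\alpha_tw_{t+1},\\ y_{t+1}&=y_t-\rho_t(Bw_{t+1}-Kx_{t+1}-b),\\ y_{t+1}^{ag}&=(1-\alpha_t)y_t^{ag}+\alpha_ty_{t+1}.\end{aligned}$$ *)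

(* Defs.v *)
From HB Require Import structures.
From mathcomp Require Import all_boot all_order all_algebra.
From mathcomp Require Import all_classical all_reals all_analysis.
Import Order.TTheory GRing.Theory Num.Theory numFieldNormedType.Exports.

Set Implicit Arguments.
Unset Strict Implicit.
Unset Printing Implicit Defensive.

Local Open Scope classical_set_scope.
Local Open Scope ring_scope.

(* Finite-dimensional real inner product spaces. The norm (and hence the
   topology) is the one of the underlying normed module; [norm_dot] says that
   it is induced by the inner product. *)
HB.mixin Record NormedModule_isEuclidean (R : realType) V
    of NormedModule R V & Vector R V := {
  dot : {dot V for idfun};
  norm_dot : forall u : V, `|u| ^+ 2 = dot u u
}.

#[short(type="euclidType")]
HB.structure Definition Euclidean (R : realType) :=
  {V of NormedModule_isEuclidean R V & NormedModule R V & Vector R V}.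

Notation "''<' u , v >" := (dot u v)
  (at level 2, u, v at level 60, format "''<' u ,  v >") : ring_scope.

Definition opnorm (R : realType) (U V : euclidType R) (K : {linear U -> V}) : R :=
  sup [set `|K u| | u in [set u : U | `|u| <= 1]].

(* [g] is a gradient of [f] along [A]: only points of [A] enter the expansion,
   as [f] is a function on [A], which may have empty interior. *)
Definition gradient_on (R : realType) (V : euclidType R) (A : set V)
    (f : V -> R) (g : V -> V) : Prop :=
  forall u, A u -> forall e : R, 0 < e ->
    \forall v \near within A (nbhs u),
      `|f v - f u - '<g u, v - u>| <= e * `|v - u|.

Definition is_argmin (R : realType) (T : Type) (A : set T) (f : T -> R) (a : T) :
    Prop :=
  A a /\ forall z, A z -> f a <= f z.

Section problem.
Context (R : realType) (W X Y : euclidType R).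
Context (C : set X) (G : X -> R) (F : W -> R).
Context (K : {linear X -> Y}) (B : {linear W -> Y}) (b : Y).

Definition is_optimal (w : W) (x : X) : Prop :=
  is_argmin [set p : W * X | C p.2 /\ B p.1 - K p.2 = b]
    (fun p => G p.2 + F p.1) (w, x).

Definition lagrangian (w : W) (x : X) (y : Y) : R :=
  G x + F w - '<y, B w - K x - b>.

Definition is_saddle_point (ws : W) (xs : X) (ys : Y) : Prop :=
  C xs /\
  forall w x y, C x ->
    lagrangian ws xs y <= lagrangian ws xs ys <= lagrangian w x ys.

(* Iterates are numbered from 1 to N; index 0 and indices above N are junk. *)
Record is_AADMM (gradG : X -> X) (chi : bool) (N : nat)
    (alpha theta tau rho eta : nat -> R)
    (x xmd xag : nat -> X) (w wag : nat -> W) (y yag : nat -> Y) : Prop := {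
  AADMM_x1 : C (x 1%N);
  AADMM_feas1 : B (w 1%N) = K (x 1%N) + b;
  AADMM_xag1 : xag 1%N = x 1%N;
  AADMM_wag1 : wag 1%N = w 1%N;
  AADMM_y1 : y 1%N = 0;
  AADMM_yag1 : yag 1%N = y 1%N;
  AADMM_xmd : forall t, (1 <= t <= N.-1)%N ->
    xmd t = (1 - alpha t) *: xag t + alpha t *: x t;
  AADMM_x : forall t, (1 <= t <= N.-1)%N ->
    is_argmin C (fun z =>
        '<gradG (xmd t), z>
        - chi%:R * theta t * '<B (w t) - K (x t) - b, K z>
        + (1 - chi%:R) * theta t / 2 * `|B (w t) - K z - b| ^+ 2
        + '<y t, K z> + eta t / 2 * `|z - x t| ^+ 2)
      (x t.+1);
  AADMM_xag : forall t, (1 <= t <= N.-1)%N ->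
    xag t.+1 = (1 - alpha t) *: xag t + alpha t *: x t.+1;
  AADMM_w : forall t, (1 <= t <= N.-1)%N ->
    is_argmin [set: W] (fun z =>
        F z - '<y t, B z> + tau t / 2 * `|B z - K (x t.+1) - b| ^+ 2)
      (w t.+1);
  AADMM_wag : forall t, (1 <= t <= N.-1)%N ->
    wag t.+1 = (1 - alpha t) *: wag t + alpha t *: w t.+1;
  AADMM_y : forall t, (1 <= t <= N.-1)%N ->
    y t.+1 = y t - rho t *: (B (w t.+1) - K (x t.+1) - b);
  AADMM_yag : forall t, (1 <= t <= N.-1)%N ->
    yag t.+1 = (1 - alpha t) *: yag t + alpha t *: y t.+1
}.

End problem.

(* Main.v *)
Require Import Defs.
From HB Require Import structures.
From mathcomp Require Import all_boot all_order all_algebra.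
From mathcomp Require Import all_classical all_reals all_analysis.
From mathcomp Require Import ring lra.
Import Order.TTheory GRing.Theory Num.Theory numFieldNormedType.Exports.

Set Implicit Arguments.
Unset Strict Implicit.
Unset Printing Implicit Defensive.

Local Open Scope classical_set_scope.
Local Open Scope ring_scope.

(** The proof is a Lyapunov argument. For a fixed multiplier [v], one iteration
    decreases the potential
      [eta / 2 * |x - xs|^2 + rho / 2 * |B (w - ws)|^2 + |y - v|^2 / (2 * rho)
       - chi * rho / 2 * |K (x - xs)|^2]
    by at least the Lagrangian gap
      [G x' + F w' - '<v, B w' - K x' - b> - (G xs + F ws)]
    at the new point ([step_decrease]). Three facts give this. The minimizers
    satisfy variational inequalities ([argmin_variational]). The smoothness
    bound and the gradient inequality ([convex_gradient]) turn the linearized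
    objective of the [x]-step into [G], at the price [LG / 2 * |x' - x|^2].
    Finally, since the multiplier moves along the new residual, the remaining
    inner products combine to telescoping differences of squares ([three_point]
    for the prox term, [cross_terms_telescope] for the others), up to a
    nonnegative square that is discarded. The condition on
    [eta] pays for the smoothness error and, in the linearized case [chi = 1],
    for [|K (x' - x)|^2] ([opnorm_bound]); it also keeps the potential
    nonnegative ([potential_ge_multiplier]).

    Because [alpha = 1], the extrapolated point is the iterate itself, so the
    inequality can be summed over the iterations; Jensen's inequality moves the
    sum to the averages ([mean_decrease]). The choice [v = 0 = y 1] makes the
    multiplier part of the initial potential vanish and gives the bound on the
    objective. With [v = ys] the gap of the averages is nonnegative by the saddle
    point property, so the potential bounds [|y t.+1 - ys|]; as the multipliers
    accumulate the residuals, [y 1 - y t.+1] is [t * rho] times the residual of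
    the averages ([multiplier_residual]), which gives the feasibility bound. *)

(** * Euclidean geometry *)

Section inner_product.
Context (R : realType) (V : euclidType R).
Implicit Types (u v w : V) (a : R).

Lemma dotC u v : '<u, v> = '<v, u>.
Proof. by have := @hermC _ _ _ _ (@dot R V) u v; rewrite expr0 mul1r. Qed.

Lemma dotDr u v w : '<u, v + w> = '<u, v> + '<u, w>.
Proof. exact: linearDr. Qed.

Lemma dotNr u v : '<u, - v> = - '<u, v>.
Proof. exact: linearNr. Qed.

Lemma dotZr a u v : '<u, a *: v> = a * '<u, v>.
Proof. exact: linearZr. Qed.

Lemma dotDl u v w : '<u + v, w> = '<u, w> + '<v, w>.
Proof. by rewrite dotC dotDr !(dotC w). Qed.

Lemma dotNl u v : '<- u, v> = - '<u, v>.
Proof. by rewrite dotC dotNr dotC. Qed.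

Lemma dotZl a u v : '<a *: u, v> = a * '<u, v>.
Proof. by rewrite dotC dotZr dotC. Qed.

Definition dotE := (dotDl, dotDr, dotNl, dotNr, dotZl, dotZr).

Lemma sqr_normDZ u v a :
  `|u + a *: v| ^+ 2 = `|u| ^+ 2 + a * (2 * '<u, v>) + a ^+ 2 * `|v| ^+ 2.
Proof. by rewrite !norm_dot !dotE (dotC v u); ring. Qed.

Lemma three_point u v w :
  2 * '<u - v, w - u> = `|v - w| ^+ 2 - `|u - w| ^+ 2 - `|u - v| ^+ 2.
Proof. by rewrite !norm_dot !dotE (dotC w u) (dotC w v) (dotC v u); ring. Qed.

Lemma sqr_normB_le u v : `|u - v| ^+ 2 <= 2 * (`|u| ^+ 2 + `|v| ^+ 2).
Proof.
have h : `|u - v| <= `|u| + `|v| by exact: ler_normB.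
have : `|u - v| ^+ 2 <= (`|u| + `|v|) ^+ 2 by rewrite lerXn2r ?nnegrE ?addr_ge0.
by have := sqr_ge0 (`|u| - `|v|); lra.
Qed.

(** The Pythagorean theorem, as an inequality. *)
Lemma ler_norm_orthD u v : '<u, v> = 0 -> `|v| <= `|u + v|.
Proof.
move=> uv; rewrite -(@ler_pXn2r _ 2) ?nnegrE// -[in leRHS](scale1r v).
by rewrite sqr_normDZ uv; have := sqr_ge0 `|u|; lra.
Qed.

End inner_product.

Section operator_norm.
Context (R : realType) (U V : euclidType R) (K : {linear U -> V}).

(** Induction on the dimension of the subspace: a nonzero [v] splits it into a
    line, on which the bound is clear, and its orthogonal complement; both
    components of a vector are no longer than the vector itself. *)
Lemma linear_bounded_on n (S : {vspace U}) : (\dim S <= n)%N ->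
  exists2 M : R, 0 <= M & {in S, forall u, `|K u| <= M * `|u|}.
Proof.
elim: n S => [|n IHn] S.
  rewrite leqn0 dimv_eq0 => /eqP ->; exists 0 => // u.
  by rewrite memv0 => /eqP ->; rewrite linear0 !normr0 mulr0.
move=> dimS; have [S0|S0] := eqVneq S 0%VS.
  by apply: IHn; rewrite S0 dimv0.
pose v := vpick S.
have v0 : v != 0 by rewrite vpick0.
have vS : v \in S by exact: memv_pick.
have vv : '<v, v> != 0 by rewrite -norm_dot expf_eq0 normr_eq0.
have vNS : v \notin orthov (@dot R U) S.
  by apply/mem_orthovPn; exists v.
have [|M M0 KM] := IHn (S :&: orthov (@dot R U) <[v]>)%VS.
  by rewrite -(eq_dim_orthov1 vNS); case: (\dim S) dimS.
exists (`|K v| / `|v| + M); first by rewrite addr_ge0 ?divr_ge0.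
move=> u uS; pose c := '<u, v> / '<v, v>; pose u' := u - c *: v.
have u'v : '<u', v> = 0 by rewrite /u' /c !dotE divfK// subrr.
have u'S : u' \in (S :&: orthov (@dot R U) <[v]>)%VS.
  by rewrite memv_cap rpredB ?rpredZ//= mem_orthov1; exact/eqP.
have uE : u = c *: v + u' by rewrite addrC subrK.
have le1 : `|u'| <= `|u|.
  by rewrite [X in _ <= `|X|]uE ler_norm_orthD// dotZl (dotC v) u'v mulr0.
have le2 : `|c *: v| <= `|u|.
  by rewrite [X in _ <= `|X|]uE addrC ler_norm_orthD// dotZr u'v mulr0.
rewrite [X in `|K X|]uE linearD (le_trans (ler_normD _ _))// mulrDl lerD//; last first.
  by rewrite (le_trans (KM _ u'S))// ler_wpM2l.
rewrite linearZ normrZ mulrAC ler_pdivlMr ?normr_gt0//.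
by rewrite mulrAC mulrC ler_wpM2l// -normrZ.
Qed.

(** Without boundedness of the image of the unit ball the supremum defining
    [opnorm] would be a default value. *)
Lemma opnorm_bound u : `|K u| <= opnorm K * `|u|.
Proof.
have [->|u0] := eqVneq u 0; first by rewrite linear0 !normr0 mulr0.
have nu : 0 < `|u| by rewrite normr_gt0.
rewrite -ler_pdivrMr// /opnorm.
have -> : `|K u| / `|u| = `|K (`|u|^-1 *: u)|.
  by rewrite linearZ normrZ ger0_norm ?invr_ge0// mulrC.
apply: ub_le_sup; last first.
  by exists (`|u|^-1 *: u) => //=; rewrite normrZ ger0_norm ?invr_ge0// mulVf ?gt_eqF.
have [M M0 KM] := linear_bounded_on (leqnn (\dim {:U})).
exists M => _ [v /= v1 <-]; rewrite (le_trans (KM _ (memvf _)))//.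
by rewrite ler_piMr.
Qed.

Lemma opnorm_ge0 : 0 <= opnorm K.
Proof.
rewrite /opnorm; set S := [set _ | _ in _].
have S0 : S 0 by exists 0; rewrite /= ?linear0 normr0.
have [Sb|Sb] := pselect (has_ubound S); first exact: ub_le_sup.
by rewrite sup_out// => -[].
Qed.

End operator_norm.

(** * Convexity and first-order optimality *)

Section convexity.
Context (R : realType) (V : euclidType R) (C : set V).
Implicit Types (f : V -> R) (u v : V) (s : R).

Lemma convex_set_segment u v s : convex_set C -> C u -> C v -> 0 <= s <= 1 ->
  C (u + s *: (v - u)).
Proof.
move=> Cc Cu Cv /andP[s0 s1].
have -> : u + s *: (v - u) = s *: v + (1 - s) *: u.
  by rewrite scalerBl scale1r scalerBr addrCA.
by have := Cc v u (Itv01 s0 s1); rewrite !inE => /(_ Cv Cu).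
Qed.

Lemma convex_function_segment f u v s : convex_function C f -> C u -> C v ->
  0 <= s <= 1 -> f (u + s *: (v - u)) <= f u + s * (f v - f u).
Proof.
move=> fc Cu Cv /andP[s0 s1].
have := fc (Itv01 s0 s1) v u; rewrite !inE => /(_ Cv Cu).
have -> : u + s *: (v - u) = s *: v + (1 - s) *: u.
  by rewrite scalerBl scale1r scalerBr addrCA.
move/le_trans; apply; rewrite convRE /=.
rewrite -[leLHS]/(s * f v + (1 - s) * f u : R); lra.
Qed.

(** Jensen's inequality for the uniform average: the mean of [n + 2] points is
    on the segment from the mean of the first [n + 1] to the last one. *)
Lemma convex_function_mean f (u : nat -> V) n : convex_set C ->
  convex_function C f -> (forall i, (i < n.+1)%N -> C (u i)) ->
  let m := n.+1%:R^-1 *: \sum_(0 <= i < n.+1) u i in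
  C m /\ f m <= n.+1%:R^-1 * \sum_(0 <= i < n.+1) f (u i).
Proof.
move=> Cc fc; elim: n => [|n IHn] Cu /=.
  by rewrite !big_nat1 invr1 scale1r mul1r; split => //; exact: Cu.
have [Cm fm] := IHn (fun i ni => Cu i (ltnW ni)); move: Cm fm.
set S := \sum_(0 <= i < n.+1) u i; set T := \sum_(0 <= i < n.+1) f (u i).
move=> Cm fm; pose s : R := n.+2%:R^-1.
have s01 : 0 <= s <= 1 by rewrite invr_ge0 ler0n invf_le1 ?ltr0n// ler1n.
have sE : (1 - s) * n.+1%:R^-1 = s.
  rewrite /s -[n.+2]addn1 natrD; field.
  by rewrite !nat1r natr1 !pnatr_eq0.
have mE : n.+2%:R^-1 *: \sum_(0 <= i < n.+2) u i =
    n.+1%:R^-1 *: S + s *: (u n.+1 - n.+1%:R^-1 *: S).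
  rewrite big_nat_recr//= -/S -/s scalerDr scalerBr addrCA addrC; congr (_ + _).
  by rewrite -[X in X - _]scale1r -scalerBl scalerA sE.
have Cu1 : C (u n.+1) by exact: Cu.
rewrite mE; split; first exact: convex_set_segment.
rewrite (le_trans (convex_function_segment fc Cm Cu1 s01))//.
rewrite big_nat_recr//= -/T -/s [leRHS]mulrDr.
have /andP[s0 s1] := s01.
have -> : s * T = (1 - s) * (n.+1%:R^-1 * T) by rewrite mulrA sE.
have : (1 - s) * f (n.+1%:R^-1 *: S) <= (1 - s) * (n.+1%:R^-1 * T).
  by rewrite ler_wpM2l// subr_ge0.
by move: (f (_ *: S)) (_ * T) (f (u n.+1)) => a c b; lra.
Qed.

(** Dividing by [s] and letting [s] tend to 0. *)
Lemma ge0_first_order (a q : R) :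
  (forall s, 0 < s <= 1 -> 0 <= s * a + s ^+ 2 * q) -> 0 <= a.
Proof.
move=> h; rewrite leNgt; apply/negP => a0.
have q0 : 0 < `|q| + 1 by rewrite ltr_wpDl.
pose s := Num.min 1 (- a / (2 * (`|q| + 1))).
have s0 : 0 < s by rewrite lt_min ltr01 divr_gt0 ?oppr_gt0 ?mulr_gt0.
have /h : 0 < s <= 1 by rewrite s0 ge_min lexx.
rewrite expr2 -mulrA -mulrDr pmulr_rge0// leNgt => /negP; apply.
have sle : s <= - a / (2 * (`|q| + 1)) by rewrite ge_min lexx orbT.
have : s * (`|q| + 1) <= - a / 2.
  rewrite (le_trans (ler_wpM2r (ltW q0) sle))// le_eqVlt; apply/orP; left.
  by apply/eqP; field; rewrite gt_eqF.
have : s * q <= s * `|q| by rewrite ler_wpM2l ?ler_norm// ltW.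
lra.
Qed.

(** Comparing the minimizer [u] with the points of the segment from [u] to [v]
    and dividing by the length: the convex part contributes a difference of
    values, the quadratic part [q] its directional derivative [l]. *)
Lemma argmin_variational f q u v l m : convex_set C -> convex_function C f ->
  is_argmin C (fun z => f z + q z) u -> C v ->
  (forall s, q (u + s *: (v - u)) = q u + s * l + s ^+ 2 * m) ->
  0 <= f v - f u + l.
Proof.
move=> Cc fc [Cu umin] Cv qE; apply: (@ge0_first_order _ m) => s /andP[s0 s1].
have s01 : 0 <= s <= 1 by rewrite s1 ltW.
have := umin _ (convex_set_segment Cc Cu Cv s01).
rewrite qE; have := convex_function_segment fc Cu Cv s01; lra.
Qed.

(** Convexity bounds the increment of [f] along the segment from [u] to [v] by
    a multiple of [f v - f u], and the gradient describes this increment to first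
    order. *)
Lemma convex_gradient f g u v : convex_set C -> convex_function C f ->
  gradient_on C f g -> C u -> C v -> '<g u, v - u> <= f v - f u.
Proof.
move=> Cc fc fg Cu Cv; apply/ler_addgt0Pr => e e0.
pose e' := e / (`|v - u| + 1).
have n0 : 0 < `|v - u| + 1 by rewrite ltr_wpDl.
have e'0 : 0 < e' by rewrite divr_gt0.
have /nbhs_ballP[d /= d0 hd] := fg u Cu e' e'0.
(* The factor 2 puts the point of parameter [s] inside the open ball. *)
pose s := Num.min 1 (d / (2 * (`|v - u| + 1))).
have s0 : 0 < s by rewrite lt_min ltr01 divr_gt0 ?mulr_gt0.
have s01 : 0 <= s <= 1 by rewrite ltW// ge_min lexx.
have sle : s <= d / (2 * (`|v - u| + 1)) by rewrite ge_min lexx orbT.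
have := hd (u + s *: (v - u)) _ (convex_set_segment Cc Cu Cv s01).
rewrite -ball_normE/= opprD addrA subrr sub0r normrN [u + _ - u]addrAC subrr add0r.
rewrite normrZ (ger0_norm (ltW s0)) => /(_ _)/wrap[].
  have : s * (`|v - u| + 1) <= d / 2.
    rewrite (le_trans (ler_wpM2r (ltW n0) sle))// le_eqVlt; apply/orP; left.
    by apply/eqP; field; rewrite gt_eqF.
  by lra.
rewrite dotZr ler_norml => /andP[h _].
have := convex_function_segment fc Cu Cv s01.
rewrite -[_ <= _ + e](ler_pM2l s0).
have : e' * (s * `|v - u|) <= s * e.
  by rewrite mulrCA ler_pM2l// /e' mulrAC ler_pdivrMr// ler_pM2l// lerDl//.
by move: (f u) (f v) (f (u + _)) h => a b c; lra.
Qed.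

End convexity.

(** * One iteration *)

Section iteration.
Context (R : realType) (W X Y : euclidType R).
Context (C : set X) (G : X -> R) (gradG : X -> X) (F : W -> R).
Context (K : {linear X -> Y}) (B : {linear W -> Y}) (b : Y) (LG : R).
Hypotheses (C_convex : convex_set C) (G_convex : convex_function C G).
Hypotheses (F_convex : convex_function [set: W] F).
Hypothesis G_grad : gradient_on C G gradG.
Hypothesis G_LG : forall x1 x2 : X, C x1 -> C x2 ->
  G x2 - G x1 - '<gradG x1, x2 - x1> <= LG / 2 * `|x2 - x1| ^+ 2.
Context (chi : bool) (rho eta : R) (rho_gt0 : 0 < rho).
Hypothesis eta_ge : LG + chi%:R * rho * opnorm K ^+ 2 <= eta.

(** The objective is a quadratic function of [z], so the convex part in
    [argmin_variational] is zero. *)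
Lemma x_step_variational (g x x' z : X) (w : W) (y : Y) :
  is_argmin C (fun z =>
      '<g, z> - chi%:R * rho * '<B w - K x - b, K z>
      + (1 - chi%:R) * rho / 2 * `|B w - K z - b| ^+ 2
      + '<y, K z> + eta / 2 * `|z - x| ^+ 2) x' ->
  C z ->
  0 <= '<g, z - x'> - chi%:R * rho * '<B w - K x - b, K (z - x')>
    - (1 - chi%:R) * rho * '<B w - K x' - b, K (z - x')>
    + '<y, K (z - x')> + eta * '<x' - x, z - x'>.
Proof.
move=> [Cx' xmin] Cz.
pose q z := '<g, z> - chi%:R * rho * '<B w - K x - b, K z>
      + (1 - chi%:R) * rho / 2 * `|B w - K z - b| ^+ 2
      + '<y, K z> + eta / 2 * `|z - x| ^+ 2.
have f0 : convex_function C (fun=> 0).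
  by move=> s u v _ _; rewrite convRE !mulr0 addr0.
have xmin' : is_argmin C (fun z => 0 + q z) x'.
  by split => // u /xmin; rewrite !add0r.
pose d := z - x'.
pose m := (1 - chi%:R) * rho / 2 * `|K d| ^+ 2 + eta / 2 * `|d| ^+ 2.
apply: le_trans (argmin_variational (m := m) C_convex f0 xmin' Cz _) _; last first.
  by rewrite subrr add0r; exact: lexx.
move=> s; rewrite -/d; clearbody d.
have KE : K (x' + s *: d) = K x' + s *: K d by rewrite linearD linearZ.
have -> : q (x' + s *: d) =
    '<g, x'> + s * '<g, d>
    - chi%:R * rho * ('<B w - K x - b, K x'> + s * '<B w - K x - b, K d>)
    + (1 - chi%:R) * rho / 2 * (`|B w - K x' - b| ^+ 2
        + (- s) * (2 * '<B w - K x' - b, K d>) + (- s) ^+ 2 * `|K d| ^+ 2)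
    + ('<y, K x'> + s * '<y, K d>)
    + eta / 2 * (`|x' - x| ^+ 2 + s * (2 * '<x' - x, d>) + s ^+ 2 * `|d| ^+ 2).
  rewrite -!sqr_normDZ /q KE !dotDr !dotZr.
  congr (_ + _ * _ ^+ 2 + _ + _ * _ ^+ 2).
    by congr (Num.norm _); rewrite scaleNr opprD addrA [LHS]addrAC.
  by congr (Num.norm _); rewrite [LHS]addrAC.
by rewrite /q /m; field.
Qed.

Lemma w_step_variational (x' : X) (w' v : W) (y : Y) :
  is_argmin [set: W] (fun z =>
      F z - '<y, B z> + rho / 2 * `|B z - K x' - b| ^+ 2) w' ->
  0 <= F v - F w' - '<y, B (v - w')> + rho * '<B w' - K x' - b, B (v - w')>.
Proof.
move=> [_ wmin].
pose q z := - '<y, B z> + rho / 2 * `|B z - K x' - b| ^+ 2.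
have wmin' : is_argmin [set: W] (fun z => F z + q z) w'.
  by split => // u /wmin; rewrite !addrA.
have Wc : convex_set [set: W] by move=> *; rewrite inE.
rewrite -[leRHS]addrA.
apply: (argmin_variational (m := rho / 2 * `|B (v - w')| ^+ 2) Wc F_convex wmin') => //.
move=> s; move: (v - w') => d.
have -> : q (w' + s *: d) = - ('<y, B w'> + s * '<y, B d>)
   + rho / 2 * (`|B w' - K x' - b| ^+ 2
        + s * (2 * '<B w' - K x' - b, B d>) + s ^+ 2 * `|B d| ^+ 2).
  rewrite -!sqr_normDZ /q linearD linearZ !dotDr !dotZr.
  congr (_ + _ * _ ^+ 2); congr (Num.norm _).
  by rewrite [RHS]addrAC; congr (_ + _); rewrite [LHS]addrAC.
by rewrite /q; field.
Qed.

(** For [e = K (xs - x')], [f = K (xs - x)], [u' = B (w' - ws)] and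
    [u = B (w - ws)], feasibility of [(ws, xs)] makes [u' + e] the new constraint
    residual. The two sides differ by exactly [rho / 2 * |u + e|^2], whichever
    way the coupling term is treated. *)
Lemma cross_terms_telescope (e f u u' y v : Y) :
  - (chi%:R * rho * '<u + f, e>) - (1 - chi%:R) * rho * '<u + e, e>
  + '<y, e> + '<y, u'> - rho * '<u' + e, u'> - '<v, u' + e>
  <= rho / 2 * (`|u| ^+ 2 - `|u'| ^+ 2)
     + (2 * rho)^-1 * (`|y - v| ^+ 2 - `|y - rho *: (u' + e) - v| ^+ 2)
     - chi%:R * rho / 2 * (`|f| ^+ 2 - `|e| ^+ 2 - `|e - f| ^+ 2).
Proof.
rewrite -subr_ge0 [X in 0 <= X](_ : _ = rho / 2 * `|u + e| ^+ 2); last first.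
  rewrite !norm_dot !dotE.
  rewrite ?(dotC f e) ?(dotC u e) ?(dotC u' e) ?(dotC y e) ?(dotC v e).
  rewrite ?(dotC u f) ?(dotC u' u) ?(dotC y u') ?(dotC v u') ?(dotC v y).
  by case: chi => /=; field; rewrite gt_eqF.
by rewrite mulr_ge0// divr_ge0// ltW.
Qed.

(** The last term comes from linearizing the coupling term ([chi = 1]): this
    adds [rho * '<K (x - x'), K (xs - x')>] to the estimate, whose polarization
    telescopes with the opposite sign to the prox term. *)
Definition potential (ws : W) (xs : X) (v : Y) (x : X) (w : W) (y : Y) : R :=
  eta / 2 * `|x - xs| ^+ 2 + rho / 2 * `|B (w - ws)| ^+ 2
  + (2 * rho)^-1 * `|y - v| ^+ 2 - chi%:R * rho / 2 * `|K (x - xs)| ^+ 2.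

(** Since [eta] dominates [chi * rho * |K|^2], the first term of the potential
    absorbs the negative one. *)
Lemma potential_ge_multiplier ws xs v x w y :
  0 <= LG -> (2 * rho)^-1 * `|y - v| ^+ 2 <= potential ws xs v x w y.
Proof.
move=> LG0; rewrite /potential.
have h1 : 0 <= rho / 2 * `|B (w - ws)| ^+ 2 by rewrite mulr_ge0// divr_ge0// ltW.
have h2 : `|K (x - xs)| ^+ 2 <= opnorm K ^+ 2 * `|x - xs| ^+ 2.
  by rewrite -exprMn lerXn2r ?nnegrE ?mulr_ge0 ?opnorm_ge0 ?opnorm_bound.
have h3 : chi%:R * rho * opnorm K ^+ 2 * `|x - xs| ^+ 2 <= eta * `|x - xs| ^+ 2.
  by rewrite ler_wpM2r// (le_trans _ eta_ge)// lerDr.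
have h4 : chi%:R * rho * `|K (x - xs)| ^+ 2 <=
    chi%:R * rho * (opnorm K ^+ 2 * `|x - xs| ^+ 2).
  by rewrite ler_wpM2l// mulr_ge0 ?ler0n// ltW.
lra.
Qed.

(** The prox term leaves [- eta / 2 * |x' - x|^2], which absorbs both the
    smoothness error [LG / 2 * |x' - x|^2] and the linearization error
    [chi * rho / 2 * |K (x' - x)|^2]. *)
Lemma step_decrease ws xs v (x x' : X) (w w' : W) (y y' : Y) :
  C xs -> B ws - K xs = b -> C x ->
  is_argmin C (fun z =>
      '<gradG x, z> - chi%:R * rho * '<B w - K x - b, K z>
      + (1 - chi%:R) * rho / 2 * `|B w - K z - b| ^+ 2
      + '<y, K z> + eta / 2 * `|z - x| ^+ 2) x' ->
  is_argmin [set: W] (fun z =>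
      F z - '<y, B z> + rho / 2 * `|B z - K x' - b| ^+ 2) w' ->
  y' = y - rho *: (B w' - K x' - b) ->
  lagrangian G F K B b w' x' v - (G xs + F ws)
    <= potential ws xs v x w y - potential ws xs v x' w' y'.
Proof.
move=> Cxs feas Cx xmin wmin y'E.
have Cx' : C x' by case: xmin.
have := x_step_variational xmin Cxs.
have := w_step_variational ws wmin.
have := G_LG Cx Cx'.
have := convex_gradient C_convex G_convex G_grad Cx Cxs.
have gE : '<gradG x, xs - x'> = '<gradG x, xs - x> - '<gradG x, x' - x>.
  by rewrite !dotE; ring.
pose e := K (xs - x'); pose f := K (xs - x).
pose u := B (w - ws); pose u' := B (w' - ws).
have bE : b = B ws - K xs by [].
have rE : B w - K x - b = u + f.
  by rewrite bE /u /f !linearB opprK addrACA [- _ + _]addrC.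
have rE' : B w' - K x' - b = u' + e.
  by rewrite bE /u' /e !linearB opprK addrACA [- _ + _]addrC.
have mE : B w - K x' - b = u + e.
  by rewrite bE /u /e !linearB opprK addrACA [- _ + _]addrC.
have KE : `|K (x' - x)| = `|e - f|.
  rewrite /e /f -linearB -normrN -linearN; congr (Num.norm (K _)).
  by rewrite opprB addrAC subKr.
have h2 : `|K (x' - x)| ^+ 2 <= opnorm K ^+ 2 * `|x' - x| ^+ 2.
  by rewrite -exprMn lerXn2r ?nnegrE ?mulr_ge0 ?opnorm_ge0 ?opnorm_bound.
have h3 : chi%:R * rho * opnorm K ^+ 2 * `|x' - x| ^+ 2
     <= (eta - LG) * `|x' - x| ^+ 2.
  by rewrite ler_wpM2r// lerBrDl.
have h4 : chi%:R * rho * `|K (x' - x)| ^+ 2 <=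
    chi%:R * rho * (opnorm K ^+ 2 * `|x' - x| ^+ 2).
  by rewrite ler_wpM2l// mulr_ge0 ?ler0n// ltW.
have uN : B (ws - w') = - u' by rewrite /u' -linearN opprB.
have := cross_terms_telescope e f u u' y v.
rewrite /lagrangian /potential y'E rE rE' mE gE uN -/e !dotNr -/u -/u'.
rewrite KE in h2 h3 h4.
rewrite (_ : `|K (x - xs)| = `|f|); last by rewrite /f -normrN -linearN opprB.
rewrite (_ : `|K (x' - xs)| = `|e|); last by rewrite /e -normrN -linearN opprB.
(* This makes the prox term telescope. *)
have := congr1 ( *%R eta) (three_point x' x xs).
move: (G xs) (F ws) (G x) (G x') (F w') => Gs Fs Gx Gx' Fw'.
lra.
Qed.

(** * Averaging the iterates *)

Context (N : nat) (x xmd xag : nat -> X) (w wag : nat -> W) (y yag : nat -> Y).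
Hypothesis algo : is_AADMM C F K B b gradG chi N
  (fun=> 1) (fun=> rho) (fun=> rho) (fun=> rho) (fun=> eta)
  x xmd xag w wag y yag.

Lemma run_decrease ws xs v i : C xs -> B ws - K xs = b -> (1 <= i <= N.-1)%N ->
  lagrangian G F K B b (w i.+1) (x i.+1) v - (G xs + F ws)
    <= potential ws xs v (x i) (w i) (y i)
       - potential ws xs v (x i.+1) (w i.+1) (y i.+1).
Proof.
move=> Cxs feas iN; have Cx : C (x i).
  case: i iN => [|[|i]]// iN; first exact: AADMM_x1 algo.
  by case: (AADMM_x algo (t := i.+1)) => //; exact: ltnW iN.
apply: step_decrease => //; last 2 first.
- exact: AADMM_w algo _ iN.
- exact: AADMM_y algo _ iN.
have := AADMM_x algo iN; rewrite (AADMM_xmd algo iN) subrr scale0r add0r scale1r.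
exact.
Qed.

Context (t : nat) (t_gt0 : (0 < t)%N) (t_lt : (t <= N.-1)%N).

Definition mean (V : lmodType R) (u : nat -> V) : V :=
  t%:R^-1 *: \sum_(2 <= i < t.+2) u i.

Let t_neq0 : t%:R != 0 :> R. Proof. by rewrite pnatr_eq0 -lt0n. Qed.

Lemma iterate_range i : (i < t)%N -> (1 <= i.+1 <= N.-1)%N.
Proof. by move=> it; rewrite /= (leq_trans it). Qed.

Lemma convex_mean (V : euclidType R) (D : set V) (f : V -> R) (u : nat -> V) :
  convex_set D -> convex_function D f ->
  (forall i, (i < t)%N -> D (u i.+2)) ->
  D (mean u) /\ t%:R * f (mean u) <= \sum_(2 <= i < t.+2) f (u i).
Proof.
rewrite /mean !big_add1 /=; move: t_neq0; case: t t_gt0 => // n _ n0 Dc fc Du.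
have [Dm fm] := convex_function_mean (u := fun i => u i.+2) Dc fc Du.
split => //; rewrite -(ler_pM2l (x := n.+1%:R^-1)) ?invr_gt0 ?ltr0n//.
by rewrite mulKf.
Qed.

Lemma residual_mean :
  t%:R *: (B (mean w) - K (mean x) - b) =
  \sum_(2 <= i < t.+2) (B (w i) - K (x i) - b).
Proof.
rewrite /mean !linearZ /= -scalerDr [LHS]scalerBr scalerA divff// scale1r !linear_sum /=.
by rewrite sumrB big_split sumr_const_nat subSS subn1 scaler_nat.
Qed.

(** The multipliers record the accumulated residual. *)
Lemma multiplier_residual :
  y 1%N - y t.+1 = (t%:R * rho) *: (B (mean w) - K (mean x) - b).
Proof.
rewrite mulrC -scalerA residual_mean.
rewrite -opprB -(telescope_sumr y (ltn0Sn t)) [in RHS]big_add1 -sumrN scaler_sumr.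
apply: eq_big_nat => i /andP[i0]; rewrite ltnS => it.
have iN : (1 <= i <= N.-1)%N by rewrite i0 (leq_trans it).
by rewrite (AADMM_y algo iN) opprB opprB addrCA subrr addr0.
Qed.

Let mean_iterates_in i : (i < t)%N -> C (x i.+2).
Proof. by move=> /iterate_range iN; case: (AADMM_x algo iN). Qed.

Lemma mean_in : C (mean x).
Proof. by have [] := convex_mean C_convex G_convex mean_iterates_in. Qed.

(** The potentials telescope, and the Lagrangian is convex in its primal
    arguments. *)
Lemma mean_decrease ws xs v : C xs -> B ws - K xs = b ->
  t%:R * (lagrangian G F K B b (mean w) (mean x) v - (G xs + F ws))
    <= potential ws xs v (x 1%N) (w 1%N) (y 1%N)
       - potential ws xs v (x t.+1) (w t.+1) (y t.+1).
Proof.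
move=> Cxs feas.
pose P i := potential ws xs v (x i) (w i) (y i).
rewrite -/(P 1%N) -/(P t.+1) -[leRHS]opprB -(telescope_sumr P (ltn0Sn t)) -sumrN.
have dec : \sum_(2 <= i < t.+2) (lagrangian G F K B b (w i) (x i) v
    - (G xs + F ws)) <= \sum_(1 <= i < t.+1) - (P i.+1 - P i).
  rewrite big_add1; apply: ler_sum_nat => i /andP[i0]; rewrite ltnS => it; rewrite opprB.
  by apply: run_decrease => //; rewrite i0 (leq_trans it).
apply: le_trans dec.
have [_ Gm] := convex_mean C_convex G_convex mean_iterates_in.
have [|_ Fm] := @convex_mean W [set: W] F w _ F_convex (fun _ _ => I).
  by move=> *; rewrite inE.
rewrite sumrB sumr_const_nat subSS subn1 /= -[(_ + _) *+ t]mulr_natl [leLHS]mulrBr lerD2r.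
rewrite /lagrangian sumrB big_split /= mulrBr mulrDr lerD ?lerD// lerN2.
by rewrite -dotZr residual_mean linear_sumr.
Qed.

End iteration.

(** * Rates of convergence *)

Theorem theorem2p8 (R : realType) (W X Y : euclidType R)
    (C : set X) (G : X -> R) (gradG : X -> X) (F : W -> R)
    (K : {linear X -> Y}) (B : {linear W -> Y}) (b : Y) (LG : R)
    (C_closed : closed C) (C_convex : convex_set C)
    (G_convex : convex_function C G)
    (G_lsc : lower_semicontinuous (fun x : subspace C => (G x)%:E))
    (F_convex : convex_function [set: W] F)
    (F_lsc : lower_semicontinuous (fun w : W => (F w)%:E))
    (G_grad : gradient_on C G gradG)
    (G_C1 : {within C, continuous gradG})
    (LG_gt0 : 0 < LG)
    (G_LG : forall x1 x2 : X, C x1 -> C x2 ->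
      G x2 - G x1 - '<gradG x1, x2 - x1> <= LG / 2 * `|x2 - x1| ^+ 2)
    (ws : W) (xs : X) (ys : Y)
    (opt : is_optimal C G F K B b ws xs)
    (saddle : is_saddle_point C G F K B b ws xs ys)
    (chi : bool) (N : nat) (N_ge2 : (2 <= N)%N)
    (rho eta : R) (rho_gt0 : 0 < rho)
    (eta_ge : LG + chi%:R * rho * opnorm K ^+ 2 <= eta)
    (x xmd xag : nat -> X) (w wag : nat -> W) (y yag : nat -> Y)
    (algo : is_AADMM C F K B b gradG chi N
      (fun=> 1) (fun=> rho) (fun=> rho) (fun=> rho) (fun=> eta)
      x xmd xag w wag y yag)
    (t : nat) (t_range : (1 <= t <= N.-1)%N) :
  let fs := G xs + F ws in
  let Dx := `|x 1%N - xs| in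
  let DxK := `|K (x 1%N - xs)| in
  let Dy := `|y 1%N - ys| in
  let xbar : X := t%:R^-1 *: \sum_(2 <= i < t.+2) x i in
  let wbar : W := t%:R^-1 *: \sum_(2 <= i < t.+2) w i in
  [/\ G xbar + F wbar - fs
        <= 1 / (2 * t%:R) * (eta * Dx ^+ 2 + rho * (1 - chi%:R) * DxK ^+ 2),
      `|B wbar - K xbar - b| ^+ 2
        <= 2 / t%:R ^+ 2 * (2 * Dy ^+ 2 / rho ^+ 2 + eta * Dx ^+ 2 / rho
                            + (1 - chi%:R) * DxK ^+ 2) &
      rho = 1 -> eta = LG + chi%:R * opnorm K ^+ 2 ->
      G xbar + F wbar - fs
        <= 1 / (2 * t%:R) * (LG * Dx ^+ 2 + chi%:R * opnorm K ^+ 2 * Dx ^+ 2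
                             + (1 - chi%:R) * DxK ^+ 2)
      /\ `|B wbar - K xbar - b|
        <= 2 * Num.sqrt LG * Dx / t%:R
           + chi%:R * Num.sqrt 2 * opnorm K * Dx / t%:R
           + (1 - chi%:R) * Num.sqrt 2 * DxK / t%:R
           + 2 * Dy / t%:R].
Proof.
move=> fs Dx DxK Dy xbar wbar.
have /andP[t0 tN] := t_range.
have [[/= Cxs feas] _] := opt; have [_ saddleP] := saddle.
have tgt0 : 0 < t%:R :> R by rewrite ltr0n.
have LG0 := ltW LG_gt0.
set r := B wbar - K xbar - b.
have Cxbar : C xbar by exact: (mean_in C_convex G_convex algo t0 tN).
have decrease v : t%:R * (lagrangian G F K B b wbar xbar v - fs) <=
    potential K B chi rho eta ws xs v (x 1%N) (w 1%N) (y 1%N)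
    - potential K B chi rho eta ws xs v (x t.+1) (w t.+1) (y t.+1).
  exact: (mean_decrease C_convex G_convex F_convex G_grad G_LG
    rho_gt0 eta_ge algo t0 tN v Cxs feas).
have pot1 v : potential K B chi rho eta ws xs v (x 1%N) (w 1%N) (y 1%N) =
    eta / 2 * Dx ^+ 2 + rho / 2 * (1 - chi%:R) * DxK ^+ 2
    + (2 * rho)^-1 * `|y 1%N - v| ^+ 2.
  rewrite /potential (_ : B (w 1%N - ws) = K (x 1%N - xs)); last first.
    by rewrite !linearB (AADMM_feas1 algo) -feas addrAC addrA subrK.
  rewrite -/Dx -/DxK; ring.
have value : G xbar + F wbar - fs
    <= 1 / (2 * t%:R) * (eta * Dx ^+ 2 + rho * (1 - chi%:R) * DxK ^+ 2).
  rewrite mul1r [leRHS]mulrC ler_pdivlMr ?mulr_gt0//.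
  have := decrease 0; rewrite pot1 (AADMM_y1 algo) subr0 normr0.
  have := potential_ge_multiplier B rho_gt0 eta_ge ws xs 0
    (x t.+1) (w t.+1) (y t.+1) LG0.
  rewrite /lagrangian linear0l !subr0.
  have : 0 <= (2 * rho)^-1 * `|y t.+1| ^+ 2.
    by rewrite mulr_ge0// invr_ge0 mulr_ge0// ltW.
  move: (G _ + F _ - _) => gap; lra.
have residual : `|r| ^+ 2
    <= 2 / t%:R ^+ 2 * (2 * Dy ^+ 2 / rho ^+ 2 + eta * Dx ^+ 2 / rho
                        + (1 - chi%:R) * DxK ^+ 2).
  have gap_ge0 : 0 <= lagrangian G F K B b wbar xbar ys - fs.
    have /andP[_] := saddleP wbar xbar ys Cxbar.
    by rewrite /lagrangian feas subrr linear0r subr0 subr_ge0.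
  have := decrease ys; rewrite pot1 -/Dy.
  have := potential_ge_multiplier B rho_gt0 eta_ge ws xs ys
    (x t.+1) (w t.+1) (y t.+1) LG0.
  have := mulr_ge0 (ltW tgt0) gap_ge0.
  set E := `|y t.+1 - ys| => h1 h2 h3.
  have {h1 h2 h3} : (2 * rho)^-1 * E ^+ 2 <= eta / 2 * Dx ^+ 2
      + rho / 2 * (1 - chi%:R) * DxK ^+ 2 + (2 * rho)^-1 * Dy ^+ 2 by lra.
  rewrite mulrC ler_pdivrMr ?mulr_gt0// => hE.
  have := sqr_normB_le (y 1%N - ys) (y t.+1 - ys).
  rewrite opprB addrA subrK (multiplier_residual algo t0 tN).
  rewrite -/r normrZ gtr0_norm ?mulr_gt0// exprMn -/Dy -/E.
  rewrite mulrC -ler_pdivlMr ?exprn_gt0 ?mulr_gt0// => /le_trans; apply.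
  rewrite ler_pdivrMr ?exprn_gt0 ?mulr_gt0//.
  have -> : 2 / t%:R ^+ 2 * (2 * Dy ^+ 2 / rho ^+ 2 + eta * Dx ^+ 2 / rho
      + (1 - chi%:R) * DxK ^+ 2) * (t%:R * rho) ^+ 2 =
    2 * (Dy ^+ 2 + (eta / 2 * Dx ^+ 2
      + rho / 2 * (1 - chi%:R) * DxK ^+ 2 + (2 * rho)^-1 * Dy ^+ 2) * (2 * rho)).
    by field; rewrite !gt_eqF.
  by rewrite ler_pM2l// lerD2l.
split=> // rho1 etaE; split.
  rewrite (le_trans value)// rho1 etaE le_eqVlt; apply/orP; left.
  by apply/eqP; field; rewrite gt_eqF.
have K0 := opnorm_ge0 K.
have chi1 : 0 <= 1 - chi%:R :> R by rewrite subr_ge0 lern1 leq_b1.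
set p1 := 2 * _ * Dx / _; set p2 := _ * opnorm K * Dx / _.
set p3 := _ * DxK / _; set p4 := 2 * Dy / _.
have p1_ge0 : 0 <= p1 by rewrite divr_ge0 ?mulr_ge0 ?sqrtr_ge0 ?normr_ge0.
have p2_ge0 : 0 <= p2 by rewrite divr_ge0 ?mulr_ge0 ?sqrtr_ge0 ?normr_ge0.
have p3_ge0 : 0 <= p3 by rewrite divr_ge0 ?mulr_ge0 ?sqrtr_ge0 ?normr_ge0.
have p4_ge0 : 0 <= p4 by rewrite divr_ge0 ?mulr_ge0 ?normr_ge0.
rewrite -(@ler_pXn2r _ 2) ?nnegrE ?addr_ge0// (le_trans residual)// rho1 etaE.
have sum_sqr : p1 ^+ 2 + p2 ^+ 2 + p3 ^+ 2 + p4 ^+ 2 <= (p1 + p2 + p3 + p4) ^+ 2.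
  have := mulr_ge0 p1_ge0 p2_ge0; have := mulr_ge0 p1_ge0 p3_ge0.
  have := mulr_ge0 p1_ge0 p4_ge0; have := mulr_ge0 p2_ge0 p3_ge0.
  have := mulr_ge0 p2_ge0 p4_ge0; have := mulr_ge0 p3_ge0 p4_ge0.
  by move: (p1) (p2) (p3) (p4) => q1 q2 q3 q4; lra.
apply: le_trans sum_sqr.
(* The coefficient [2 * Num.sqrt LG], in place of [Num.sqrt 2 * Num.sqrt LG],
   accounts for the last summand. *)
have -> : p1 ^+ 2 + p2 ^+ 2 + p3 ^+ 2 + p4 ^+ 2 =
    2 / t%:R ^+ 2 * (2 * Dy ^+ 2 / 1 ^+ 2
      + (LG + chi%:R * opnorm K ^+ 2) * Dx ^+ 2 / 1 + (1 - chi%:R) * DxK ^+ 2)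
    + 2 / t%:R ^+ 2 * (LG * Dx ^+ 2).
  rewrite /p1 /p2 /p3 /p4 !exprMn !sqr_sqrtr// !exprVn.
  by case: (chi) => /=; field; rewrite gt_eqF.
by rewrite lerDl mulr_ge0 ?divr_ge0 ?mulr_ge0 ?exprn_ge0 ?normr_ge0.
Qed.
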